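(* Let $\omega\in\mathbb{R}^{\mathbb{N}}$ and let $(\mathbb{T}^{\mathbb{N}},\Phi_\omega)$ be the associated Kronecker flow. The following properties are equivalent: (a) $(\mathbb{T}^{\mathbb{N}},\Phi_\omega)$ is non-resonant; (b) it is uniquely ergodic; (c) it is minimal; (d) it is topologically transitive.
   Context: $\mathbb{N}=\{1,2,\dots\}$, $\mathbb{T}=\mathbb{R}/2\pi\mathbb{Z}$, and the infinite torus $\mathbb{T}^{\mathbb{N}}$ carries the product topology. For $\omega=(\omega_j)_{j\in\mathbb{N}}\in\mathbb{R}^{\mathbb{N}}$ the Kronecker flow is $\Phi_\omega:\mathbb{R}\times\mathbb{T}^{\mathbb{N}}\to\mathbb{T}^{\mathbb{N}}$, $\Phi_\omega^t(\theta)=(\Theta_j+\omega_jt+2\pi\mathbb{Z})_{j\in\mathbb{N}}$, where $\theta_j=\Theta_j+2\pi\mathbb{Z}$. $\mathbb{Z}^{(\mathbb{N})}$ is the group of finitely supported integer sequences. The resonance module is $\mathscr{R}_\omega=\{\nu\in\mathbb{Z}^{(\mathbb{N})}:\sum_j\omega_j\nu_j=0\}$; the flow is non-resonant if $\mathscr{R}_\omega=\{0\}$. A flow is topologically transitive if there exists a dense orbit, minimal if every orbit is dense, and uniquely ergodic if it admits a unique invariant Borel probability measure (a Borel probability measure $\mu$ with $\mu((\Phi^t)^{-1}(U))=\mu(U)$ for all $t\in\mathbb{R}$ and all Borel sets $U$). *)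

(* Defs.v *)
From HB Require Import structures.
From mathcomp Require Import all_boot all_order all_algebra.
From mathcomp Require Import generic_quotient ring_quotient.
From mathcomp Require Import all_classical all_reals all_analysis.

Set Implicit Arguments.
Unset Strict Implicit.
Unset Printing Implicit Defensive.

Import Order.TTheory GRing.Theory Num.Theory.
Import numFieldTopology.Exports numFieldNormedType.Exports.

Local Open Scope classical_set_scope.
Local Open Scope ring_scope.
Local Open Scope quotient_scope.

Section Circle.
Context {R : realType}.

Definition twopiZ : {pred R} :=
  fun x => `[< exists k : int, x = 2 * pi * k%:~R >].

Lemma twopiZ_zmod_closed : zmod_closed twopiZ.
Proof.
split; first by apply/asboolP; exists 0; rewrite mulr0.
move=> _ _ /asboolP[k ->] /asboolP[l ->]; apply/asboolP; exists (k - l).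
by rewrite intrB mulrBr.
Qed.

HB.instance Definition _ := GRing.isZmodClosed.Build R twopiZ twopiZ_zmod_closed.

End Circle.

Definition circle (R : realType) := quotient_topology (Quotient.quot (@twopiZ R)).

HB.instance Definition _ (R : realType) := Quotient.on (circle R).
HB.instance Definition _ (R : realType) := PointedTopological.on (circle R).

Definition inf_torus (R : realType) := {ptws nat -> circle R}.

HB.instance Definition _ (R : realType) := Topological.on (inf_torus R).
HB.instance Definition _ (R : realType) :=
  isPointed.Build (inf_torus R) (fun=> point).

Section Kronecker.
Context {R : realType}.
Implicit Types (omega : nat -> R).

(* The choice of the representative [repr (theta j)] is immaterial: see
   [kronecker_flow_pi]. *)
Definition kronecker_flow omega (t : R) (theta : inf_torus R) : inf_torus R :=
  fun j => \pi_(circle R) (repr (theta j) + omega j * t).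

Lemma circle_piP (x y : R) :
  \pi_(circle R) x = \pi_(circle R) y <-> exists k : int, x - y = 2 * pi * k%:~R.
Proof.
have E : x - y \in twopiZ <-> \pi_(circle R) x = \pi_(circle R) y.
  rewrite Quotient.idealrBE; split=> [/eqP e|e]; first exact: e.
  by apply/eqP; exact: e.
by rewrite -E; split=> /asboolP.
Qed.

Lemma kronecker_flow_pi omega t (Theta : nat -> R) :
  kronecker_flow omega t (fun j => \pi_(circle R) (Theta j)) =
  (fun j => \pi_(circle R) (Theta j + omega j * t)).
Proof.
apply/funext => j; apply/circle_piP; rewrite opprD addrACA subrr addr0.
by apply/circle_piP; rewrite reprK.
Qed.

Definition resonance_module omega : set (nat -> int) :=
  [set nu | finite_set [set j | nu j != 0] /\
            \sum_(j \in [set: nat]) omega j * (nu j)%:~R = 0].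

Definition non_resonant omega := resonance_module omega = [set 0].

End Kronecker.

Definition borel (X : ptopologicalType) := g_sigma_algebraType (@open X).

HB.instance Definition _ (X : ptopologicalType) := Measurable.on (borel X).

Section Flow.
Context {R : realType} {X : ptopologicalType}.
Implicit Types (Phi : R -> X -> X).

Definition flow_orbit Phi (x : X) : set X := [set Phi t x | t in [set: R]].

Definition topologically_transitive Phi := exists x, dense (flow_orbit Phi x).

Definition minimal Phi := forall x, dense (flow_orbit Phi x).

Definition invariant_measure Phi (mu : probability (borel X) R) :=
  forall (t : R) (U : set X), @measurable _ (borel X) U -> mu (Phi t @^-1` U) = mu U.

(* Measures are functions on all subsets, with irrelevant values outside of the
   sigma-algebra, so two Borel measures are compared on Borel sets only. *)
Definition uniquely_ergodic Phi :=
  exists mu : probability (borel X) R, invariant_measure Phi mu /\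
    forall nu : probability (borel X) R, invariant_measure Phi nu ->
      forall U : set X, @measurable _ (borel X) U -> nu U = mu U.

End Flow.

(* Main.v *)
Require Import Defs.
From HB Require Import structures.
From mathcomp Require Import all_boot all_order all_algebra.
From mathcomp Require Import all_classical all_reals all_analysis.
From mathcomp Require Import measurable_realfun.
From mathcomp Require Import ring lra zify.

(** Everything is Fourier analysis on the torus, done with the real characters
    [cos (<p, theta> + b)], where [p] is a finitely supported integer frequency
    and [b] an arbitrary shift.  Along a Kronecker flow such a character
    oscillates with the single frequency [<p, omega>], which vanishes exactly
    when [p] is a resonance.

    Two facts carry the proof.  First, a Borel probability is determined by its
    integrals against characters ([fourier_uniqueness]): boxes of arcs form a
    countable base that is closed under intersection, and the indicator of a box
    is a bounded pointwise limit of trigonometric polynomials.  Second, there is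
    a probability [haar] whose integral against every character of nonzero
    frequency is [0] ([haar_character]).  It is the law of the angles obtained
    by distributing the binary digits of a uniform number in the unit interval
    over countably many digit sequences: flipping a suitable digit preserves
    Lebesgue measure and changes the sign of the character.

    Non-resonant implies uniquely ergodic: if [p] is nonzero, the time
    [pi / <p, omega>] of the flow turns a character of frequency [p] into its
    opposite, so its integral against an invariant probability vanishes, and the
    probability is [haar].

    Uniquely ergodic implies non-resonant: if [p] is a nonzero resonance with
    [p_k] nonzero, the image of [haar] under the endomorphism that multiplies
    every angle by [p_k] and then subtracts [<p, theta>] from the [k]-th one is
    invariant too, but it is carried by the subgroup [<p, theta> = 0], so it
    differs from [haar].

    Non-resonant implies minimal: replacing [g t] by the mean of [g t] and
    [g (t + pi / alpha)] removes the frequency [alpha] from a trigonometric sum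
    on the line and preserves every upper bound ([constant_term_le]).  Applied
    to the approximations of the indicator of a box, which are uniformly small
    off the box, it shows that a box missed by an orbit is [haar]-null, whereas
    a nonempty box has positive measure because countably many of its translates
    cover the torus.

    Transitive implies non-resonant: the characters of a resonance are constant
    along orbits, hence cannot be both [1] along a dense orbit and [-1]
    somewhere. *)

Set Implicit Arguments.
Unset Strict Implicit.
Unset Printing Implicit Defensive.

Import Order.TTheory GRing.Theory Num.Theory.
Import numFieldTopology.Exports numFieldNormedType.Exports.

Local Open Scope classical_set_scope.
Local Open Scope ring_scope.
Local Open Scope quotient_scope.

(** * Phases and characters *)

Section Phase.
Context {R : realType}.
Implicit Types (p q : {poly int}) (Th : nat -> R).

(** The pairing of [Th] with a finitely supported integer sequence.  Such
    sequences are represented as polynomials with integer coefficients, which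
    supplies their group structure. *)
Definition phase p Th : R := \sum_(j < size p) (p`_j)%:~R * Th j.

Lemma phase_widen n p Th : (size p <= n)%N ->
  phase p Th = \sum_(j < n) (p`_j)%:~R * Th j.
Proof.
move=> pn; rewrite /phase -!(big_mkord xpredT (fun j => (p`_j)%:~R * Th j)).
rewrite (big_cat_nat _ pn) //= [X in _ + X]big_nat_cond [X in _ + X]big1 ?addr0 //.
by move=> j /andP[/andP[pj _] _]; rewrite nth_default// mul0r.
Qed.

Lemma phaseDl p q Th : phase (p + q) Th = phase p Th + phase q Th.
Proof.
pose n := maxn (size p) (size q).
rewrite !(@phase_widen n) ?leq_maxl ?leq_maxr ?size_polyD//.
by rewrite -big_split/=; apply: eq_bigr => j _; rewrite coefD intrD mulrDl.
Qed.

Lemma phaseZl a p Th : phase (a *: p) Th = a%:~R * phase p Th.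
Proof.
rewrite (@phase_widen (size p)) ?size_scale_leq// mulr_sumr.
by apply: eq_bigr => j _; rewrite coefZ intrM mulrA.
Qed.

Lemma phaseNl p Th : phase (- p) Th = - phase p Th.
Proof. by rewrite -scaleN1r phaseZl mulN1r. Qed.

Lemma phase0l Th : phase 0 Th = 0.
Proof. by rewrite /phase size_poly0 big_ord0. Qed.

Lemma phaseXn i Th : phase 'X^i Th = Th i.
Proof.
rewrite /phase size_polyXn big_ord_recr/= coefXn eqxx mul1r big1 ?add0r// => j _.
by rewrite coefXn ltn_eqF// mul0r.
Qed.

Lemma phaseDr p Th Th' :
  phase p (fun j => Th j + Th' j) = phase p Th + phase p Th'.
Proof. by rewrite -big_split/=; apply: eq_bigr => j _; rewrite mulrDr. Qed.

Lemma phaseZr p Th t : phase p (fun j => Th j * t) = phase p Th * t.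
Proof. by rewrite mulr_suml; apply: eq_bigr => j _; rewrite mulrA. Qed.

Lemma phase_single p i c :
  phase p (fun j => if j == i then c else 0) = (p`_i)%:~R * c.
Proof.
rewrite (@phase_widen (maxn (size p) i.+1)) ?leq_maxl//.
have ip : (i < maxn (size p) i.+1)%N by rewrite leq_maxr.
rewrite (bigD1 (Ordinal ip))//= eqxx big1 ?addr0// => j ji.
have /negbTE -> : (j : nat) != i by apply: contraNneq ji => e; exact/eqP/val_inj.
by rewrite mulr0.
Qed.

Lemma measurable_phase d (T : measurableType d) p (Th : T -> nat -> R) :
  (forall j, measurable_fun setT (Th^~ j)) ->
  measurable_fun setT (fun x => phase p (Th x)).
Proof.
by move=> mTh; apply: measurable_sum => j; apply: measurable_funM.
Qed.

Lemma cosD2piz (x : R) (k : int) : cos (x + 2 * pi * k%:~R) = cos x.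
Proof.
have nat_case (y : R) (n : nat) : cos (y + 2 * pi * n%:R) = cos y.
  elim: n y => [|n IH] y; first by rewrite mulr0 addr0.
  rewrite -natr1 (_ : _ + _ = y + 2 * pi * n%:R + pi *+ 2) ?cosD2pi//.
  by rewrite -mulr_natl; ring.
case: k => n; first exact: nat_case.
by rewrite NegzE mulrNz mulrN -[LHS](nat_case _ n.+1) subrK.
Qed.

(** Every sign change of a character below comes from a phase shift by an odd
    multiple of [pi]. *)
Lemma cosD_odd_pi (x : R) (k : int) : cos (x + pi * (2 * k + 1)%:~R) = - cos x.
Proof.
rewrite intrD intrM mulrDr mulr1 addrA cosDpi; congr (- _).
by rewrite -[RHS](cosD2piz _ k); congr cos; ring.
Qed.

End Phase.

Section Characters.
Context {R : realType}.
Implicit Types (p q : {poly int}) (Th a : nat -> R) (th : inf_torus R).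

(** The representatives are chosen without any continuity; only functions of
    them that are [2 * pi]-periodic in each coordinate are well behaved. *)
Definition coords th : nat -> R := fun j => repr (th j).

Definition torus_pt Th : inf_torus R := fun j => \pi_(circle R) (Th j).

Definition translate a th : inf_torus R := torus_pt (fun j => coords th j + a j).

(** Letting [b] vary covers the real and imaginary parts of the complex
    character of frequency [p] at once. *)
Definition character p (b : R) th : R := cos (phase p (coords th) + b).

(** Integer frequencies make a character insensitive to the choice of
    representatives. *)
Lemma character_torus_pt p b Th : character p b (torus_pt Th) = cos (phase p Th + b).
Proof.
have : forall j, exists k : int, coords (torus_pt Th) j = Th j + 2 * pi * k%:~R.
  move=> j; have /circle_piP[k kE] : \pi_(circle R) (coords (torus_pt Th) j) =
    \pi_(circle R) (Th j) by rewrite reprK.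
  by exists k; rewrite -kE addrC subrK.
move=> /choice[k kE]; rewrite /character
  (_ : coords _ = fun j => Th j + (k j)%:~R * (2 * pi)).
  rewrite phaseDr phaseZr; have -> : phase p (fun j => (k j)%:~R) =
    (\sum_(j < size p) p`_j * k j)%:~R :> R.
    by rewrite rmorph_sum/=; apply: eq_bigr => j _; rewrite intrM.
  by rewrite addrAC [X in _ + X]mulrC cosD2piz.
by apply/funext => j; rewrite kE [X in _ + X]mulrC.
Qed.

Lemma character_translate p b a th :
  character p b (translate a th) = character p (phase p a + b) th.
Proof. by rewrite character_torus_pt phaseDr -addrA. Qed.

Lemma kronecker_flowE (omega : nat -> R) t :
  kronecker_flow omega t = translate (fun j => omega j * t).
Proof. by []. Qed.

Lemma character_flow p b (omega : nat -> R) t th :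
  character p b (kronecker_flow omega t th) =
  character p (phase p omega * t + b) th.
Proof. by rewrite kronecker_flowE character_translate phaseZr. Qed.

Lemma character0 b th : character 0 b th = cos b.
Proof. by rewrite /character phase0l add0r. Qed.

Lemma characterM p q b c th : character p b th * character q c th =
  2^-1 * character (p + q) (b + c) th + 2^-1 * character (p - q) (b - c) th.
Proof.
rewrite /character !phaseDl phaseNl.
set x := phase p _; set y := phase q _.
have -> : x + y + (b + c) = (x + b) + (y + c) by ring.
have -> : x - y + (b - c) = (x + b) - (y + c) by ring.
by move: (x + b) (y + c) => u v; rewrite cosD cosB; field.
Qed.

(** Although [coords] is discontinuous, a periodic continuous function of one
    angle descends to the quotient. *)
Lemma character_coord_continuous i (k : int) b :
  continuous (fun th : inf_torus R => cos (k%:~R * coords th i + b)).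
Proof.
pose g (x : R) := cos (k%:~R * x + b).
have cg : continuous g.
  move=> x; apply: continuous_comp; last exact: continuous_cos.
  by apply: cvgD; [apply: cvgM; [exact: cvg_cst|exact: cvg_id]|exact: cvg_cst].
have crepr : continuous (g \o repr : circle R -> R).
  apply: repr_comp_continuous => //.
  move=> x y /eqP xy; have /circle_piP[l /eqP] := xy.
  rewrite subr_eq => /eqP ->; rewrite /g; apply/eqP.
  by rewrite -[RHS](cosD2piz _ (k * l)); congr cos; rewrite intrM; ring.
move=> th.
apply: (@continuous_comp (inf_torus R) (circle R) R (fun t => t i) (g \o repr)).
  exact: (@proj_continuous _ (fun=> circle R) i).
exact: crepr.
Qed.

(** The addition formula for cosines splits off one coordinate at a time; since
    it introduces sines, the induction needs all the shifts [b] at once. *)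
Lemma character_continuous p b : continuous (character p b).
Proof.
rewrite /character /phase.
elim: (size p) b => [|n IH] b th; rewrite /=.
  under eq_fun do rewrite big_ord0 add0r.
  exact: cvg_cst.
have -> : (fun t : inf_torus R => cos (\sum_(j < n.+1) (p`_j)%:~R * coords t j + b)) =
  (fun t => cos (\sum_(j < n) (p`_j)%:~R * coords t j + b) *
            cos ((p`_n)%:~R * coords t n + 0)
      - cos (\sum_(j < n) (p`_j)%:~R * coords t j + (b - pi / 2)) *
            cos ((p`_n)%:~R * coords t n + (- (pi / 2)))).
  apply/funext => t; rewrite big_ord_recr/= addr0 addrA !cosBpihalf -cosD.
  by congr cos; rewrite addrAC.
by apply: cvgB; apply: cvgM; [exact: IH|exact: character_coord_continuous|
  exact: IH|exact: character_coord_continuous].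
Qed.

Lemma character_norm_le1 p b th : `|character p b th| <= 1.
Proof. exact: cos_max. Qed.

End Characters.

(** * Cosine arcs and a countable base of the torus *)

Section CosineArcs.
Context {R : realType}.
Implicit Types (x d : R).

Lemma cos_lt_cos_norm d x : 0 <= d <= pi -> `|x| < d -> cos d < cos x.
Proof.
move=> /andP[d0 dpi] xd; rewrite -(cos_norm x) ltr_cos ?in_itv/= ?d0//.
by rewrite normr_ge0 (le_trans (ltW xd)).
Qed.

Lemma cos_lt_cos_near d x : 0 <= d <= pi -> cos d < cos x ->
  exists l : int, `|x - 2 * pi * l%:~R| < d.
Proof.
move=> /andP[d0 dpi] cdx; have tpi : 0 < 2 * pi :> R by rewrite mulr_gt0 ?pi_gt0.
pose l := Num.floor ((x + pi) / (2 * pi)); exists l; set y := x - _.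
have ypi : `|y| <= pi.
  have /andP[] := floor_itv ((x + pi) / (2 * pi)); rewrite -/l.
  rewrite ler_pdivlMr// ltr_pdivrMr// intrD => l1 l2.
  by rewrite ler_norml /y; apply/andP; split; nra.
have : cos d < cos `|y| by rewrite cos_norm /y -mulrN -rmorphN cosD2piz.
by rewrite ltr_cos// ?in_itv/= ?d0// normr_ge0.
Qed.

End CosineArcs.

Section Boxes.
Context {R : realType}.
Implicit Types (th : inf_torus R) (i : nat * rat * nat).

Definition arc_radius (k : nat) : R := k.+1%:R^-1.

Lemma arc_radius_itv k : 0 <= arc_radius k <= pi.
Proof.
rewrite invr_ge0 ler0n/= (@le_trans _ _ 1) ?invf_le1 ?ler1n ?ltr0n//.
by rewrite (le_trans _ (pi_ge2 _))// ler1n.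
Qed.

(** The open arc of radius [arc_radius k] around the rational [q] in the [j]-th
    coordinate, for the index [(j, q, k)].  It is written as a superlevel set of
    a character so that trigonometric polynomials can approximate it. *)
Definition torus_arc i : set (inf_torus R) :=
  [set th | cos (arc_radius i.2) < character 'X^(i.1.1) (- ratr i.1.2) th].

Lemma torus_arcE i th : torus_arc i th <->
  cos (arc_radius i.2) < cos (coords th i.1.1 - ratr i.1.2).
Proof. by rewrite /torus_arc/= /character phaseXn. Qed.

Definition box (s : seq (nat * rat * nat)) : set (inf_torus R) :=
  [set th | forall i, i \in s -> torus_arc i th].

Lemma open_arc i : open (torus_arc i).
Proof.
rewrite (_ : torus_arc i = character 'X^(i.1.1) (- ratr i.1.2) @^-1`
  [set y | cos (arc_radius i.2) < y])//.
by apply: open_comp => [th _|]; [exact: character_continuous|exact: open_gt].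
Qed.

Lemma box_nil : box [::] = setT.
Proof. by apply/seteqP; split => th. Qed.

Lemma box_cons i s : box (i :: s) = torus_arc i `&` box s.
Proof.
apply/seteqP; split=> th.
  by move=> h; split=> [|j js]; apply: h; rewrite inE ?eqxx ?js ?orbT.
by move=> [ai bs] j; rewrite inE => /orP[/eqP ->//|/bs].
Qed.

Lemma box_cat s t : box (s ++ t) = box s `&` box t.
Proof.
by elim: s => [|i s IH]; rewrite ?box_nil ?setTI//= !box_cons IH setIA.
Qed.

Lemma open_box s : open (box s).
Proof.
elim: s => [|i s IH]; first by rewrite box_nil; exact: openT.
by rewrite box_cons; apply: openI => //; exact: open_arc.
Qed.

Lemma arc_base (V : set (circle R)) j th : open V -> V (th j) ->
  exists q k, torus_arc (j, q, k) th /\ forall th', torus_arc (j, q, k) th' -> V (th' j).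
Proof.
move=> oV Vth.
have opV : open [set x | V (\pi_(circle R) x)] by exact: oV.
have /nbhs_ballP[e/= e0 eV] : nbhs (coords th j) [set x | V (\pi_(circle R) x)].
  by apply: open_nbhs_nbhs; split=> //=; rewrite reprK.
have [k ke] : exists k, arc_radius k < e / 2.
  have [k _ /(_ _ (leqnn k)) ke] := near_infty_natSinv_lt (PosNum (divr_gt0 e0 (ltr0n _ 2))).
  by exists k.
have rk0 : 0 < arc_radius k by rewrite invr_gt0 ltr0n.
have [y [qb [q _ qE]]] := @dense_rat R (ball (coords th j) (arc_radius k))
  (ex_intro _ _ (ballxx (coords th j) rk0)) (ball_open (coords th j) (arc_radius k)).
have qb' : `|coords th j - ratr q| < arc_radius k by rewrite qE.
exists q, k; split.
  by apply/torus_arcE/cos_lt_cos_norm => //; exact: arc_radius_itv.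
move=> th' /torus_arcE /(cos_lt_cos_near (arc_radius_itv k))[l hl].
rewrite -[th' j]reprK -/(coords th' j).
have -> : \pi_(circle R) (coords th' j) = \pi_(circle R) (coords th' j - 2 * pi * l%:~R).
  by apply/circle_piP; exists l; rewrite opprB addrC subrK.
apply: eV; rewrite /ball/=.
rewrite (_ : _ - _ = (coords th j - ratr q) - (coords th' j - ratr q - 2 * pi * l%:~R)).
  by apply: le_lt_trans (ler_normB _ _) _; lra.
by ring.
Qed.

(** The product topology is a supremum of initial topologies, so convergence of
    the filter generated by the boxes around a point is checked coordinatewise. *)
Lemma box_base (U : set (inf_torus R)) th : open U -> U th ->
  exists2 s, box s th & box s `<=` U.
Proof.
move=> oU Uth; pose F := filter_from [set s | box s th] box.
have FF : Filter F.
  apply: filter_from_filter; first by exists [::]; rewrite /= box_nil.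
  by move=> s t bs bt; exists (s ++ t); rewrite /= box_cat.
suff : F --> th by move=> /(_ U); apply; apply: open_nbhs_nbhs.
apply/cvg_sup => j A.
rewrite nbhsE => -[_ [[V oV <-] /= Vth] VA].
have [q [k [ath aV]]] := arc_base oV Vth.
exists [:: (j, q, k)]; first by rewrite /= box_cons box_nil setIT.
by rewrite box_cons box_nil setIT => t /aV Vt; apply: VA.
Qed.

(** There are countably many boxes, so this is a countable union. *)
Lemma open_bigcup_box (U : set (inf_torus R)) : open U ->
  U = \bigcup_(s in [set s | box s `<=` U]) box s.
Proof.
move=> oU; apply/seteqP; split=> [th Uth|th [s sU /sU]//].
by have [s sth sU] := box_base oU Uth; exists s.
Qed.

End Boxes.

Section BorelTorus.
Context {R : realType}.
Let X := borel (inf_torus R).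

Lemma measurable_box s : measurable (box s : set X).
Proof. by apply: sub_sigma_algebra; exact: open_box. Qed.

Lemma borel_boxes : @measurable _ X = <<s range (@box R) >>.
Proof.
apply/seteqP; split; apply: smallest_sub; do ?exact: smallest_sigma_algebra.
  move=> U oU; rewrite (open_bigcup_box oU) bigcup_mkcond.
  pose Y := g_sigma_algebraType (range (@box R)).
  apply: (@countable_bigcupT_measurable _ Y); first exact: countableP.
  move=> s; case: ifPn => _; last exact: measurable0.
  by apply: sub_sigma_algebra; exists s.
by move=> _ [s _ <-]; exact: measurable_box.
Qed.

Lemma measurable_character p b : measurable_fun setT (character p b : X -> R).
Proof.
apply: (measurability _ (RGenOpens.measurableE R)) => _ [_ [x [y ->]] <-].
rewrite setTI; apply: sub_sigma_algebra; apply: open_comp; last exact: interval_open.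
by move=> th _; exact: character_continuous.
Qed.

(** Measurability is tested on characters rather than on coordinates because the
    representatives returned by [coords] may depend on the point in a
    non-measurable way. *)
Lemma measurable_torus_fun d (T : measurableType d) (f : T -> X) :
  (forall j b, measurable_fun setT (fun x => character 'X^j b (f x))) ->
  measurable_fun setT f.
Proof.
move=> mf; apply: measurability borel_boxes _ => _ [_ [s _ <-] <-].
rewrite setTI; elim: s => [|i s IH]; first by rewrite box_nil preimage_setT.
rewrite box_cons preimage_setI; apply: measurableI => //.
rewrite -[X in measurable X]setTI.
by apply: measurable_fun_ltr.
Qed.

End BorelTorus.

(** * Integrals of bounded functions *)

Section InvariantIntegral.
Context d (T : measurableType d) {R : realType}.
Implicit Types P : probability T R.

Lemma integrable_le1 P (f : T -> R) : measurable_fun setT f ->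
  (forall x, `|f x| <= 1) -> P.-integrable setT (EFin \o f).
Proof.
move=> mf f1; apply: measurable_bounded_integrable => //.
- by rewrite [ltLHS]probability_setT ltry.
- by exists 1; split=> // y y1 x _; apply: le_trans (ltW y1).
Qed.

Lemma Rintegral_distribution d' (T' : measurableType d') P (X : {mfun T >-> T'})
    (f : T' -> R) : measurable_fun setT f -> (forall y, `|f y| <= 1) ->
  \int[distribution P X]_y f y = \int[P]_x f (X x).
Proof.
move=> mf f1; rewrite /Rintegral integral_distribution//.
  exact/measurable_EFinP.
apply: (@integrable_le1 P (f \o X)); first exact: measurableT_comp.
by move=> x; exact: f1.
Qed.

Lemma Rintegral_invariant P (phi : {mfun T >-> T}) (f : T -> R) :
  (forall U, measurable U -> P (phi @^-1` U) = P U) ->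
  measurable_fun setT f -> (forall y, `|f y| <= 1) ->
  \int[P]_x f (phi x) = \int[P]_x f x.
Proof.
move=> Pphi mf f1; rewrite -Rintegral_distribution//; congr fine.
by apply: eq_measure_integral => A mA _; exact: Pphi.
Qed.

End InvariantIntegral.

(** * Polynomial approximation of a step *)

Section StepPolynomials.
Context {R : realType}.
Implicit Types (u y : R) (m n : nat).

(** As [m] grows these polynomials converge on the unit interval to the
    indicator of [u < 1/2]: [m * 2 ^ m * u ^ m = m * (2 * u) ^ m] tends to [0]
    when [u < 1/2] and is at least [m] otherwise. *)
Definition step_poly m u : R := (1 - u ^+ m) ^+ (m * 2 ^ m).

Lemma bernoulli_ineq n y : -1 <= y -> 1 + n%:R * y <= (1 + y) ^+ n.
Proof.
move=> y1; elim: n => [|n IH]; first by rewrite mul0r addr0.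
rewrite exprS; have y0 : 0 <= 1 + y by rewrite -lerBlDl sub0r.
apply: le_trans (ler_wpM2l y0 IH).
rewrite -natr1 -subr_ge0 (_ : _ - _ = n%:R * y ^+ 2); last by ring.
by rewrite mulr_ge0// sqr_ge0.
Qed.

Lemma step_poly_itv m u : 0 <= u <= 1 -> 0 <= step_poly m u <= 1.
Proof.
move=> /andP[u0 u1]; have /andP[um0 um1] : 0 <= u ^+ m <= 1 by rewrite exprn_ge0// exprn_ile1.
by rewrite exprn_ge0 ?exprn_ile1//; lra.
Qed.

(** For [y = u ^ m] and [n = m * 2 ^ m], multiplying [(1 - y) ^ n] by
    [1 + n * y <= (1 + y) ^ n] gives at most [1], and [n * y >= m].  The bound is
    uniform in [u], and the density of orbits relies on this uniformity. *)
Lemma step_poly_le m u : 2^-1 <= u <= 1 -> step_poly m u <= m.+1%:R^-1.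
Proof.
move=> /andP[u0 u1]; have u0' : 0 <= u by apply: le_trans u0; lra.
have /andP[um0 um1] : 0 <= u ^+ m <= 1 by rewrite exprn_ge0// exprn_ile1.
rewrite /step_poly; set n := (m * 2 ^ m)%N; set y := u ^+ m in um0 um1 *.
have ny : m%:R <= n%:R * y.
  rewrite natrM natrX -mulrA -exprMn ler_peMr// exprn_ege1//.
  by rewrite mulrC -ler_pdivrMr// div1r.
rewrite -[leRHS]div1r ler_pdivlMr// -natr1.
apply: (@le_trans _ _ ((1 - y) ^+ n * (1 + y) ^+ n)).
  rewrite ler_wpM2l ?exprn_ge0//; first by lra.
  by apply: le_trans (bernoulli_ineq n _); lra.
by rewrite -exprMn exprn_ile1//; nra.
Qed.

Lemma step_poly_ge u : 0 <= u < 2^-1 ->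
  exists C, forall m, 1 - C * m%:R^-1 <= step_poly m u.
Proof.
move=> /andP[u0 u2]; set r := 2 * u.
have r0 : 0 <= r by rewrite mulr_ge0.
have r1 : r < 1 by rewrite /r; lra.
(* With this [h] one has [r <= (1 + h) ^- 2], so the squared Bernoulli
   inequality yields [m * r ^ m <= h ^- 2 / m]. *)
pose h := (1 - r) / 2; have h0 : 0 < h by rewrite /h; lra.
have hr : (1 + h) ^+ 2 * r <= 1.
  rewrite -subr_ge0 (_ : _ - _ = (1 - r) ^+ 2 * (1 - r / 4)); last by rewrite /h; field.
  by rewrite mulr_ge0 ?sqr_ge0//; lra.
clearbody h; exists (h ^- 2) => m.
have um : 0 <= u ^+ m <= 1 by rewrite exprn_ge0// exprn_ile1//; lra.
apply: le_trans (bernoulli_ineq _ _); last by case/andP: um => ? ?; lra.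
rewrite lerD2l mulrN lerN2 natrM natrX -mulrA -exprMn -/r.
case: m um => [|m] _; first by rewrite mul0r invr0 mulr0.
rewrite -invfM -[leRHS]div1r ler_pdivlMr ?mulr_gt0 ?exprn_gt0//.
apply: (@le_trans _ _ ((m.+1%:R * h) ^+ 2 * r ^+ m.+1)).
  by rewrite exprMn !expr2 le_eqVlt; apply/orP; left; apply/eqP; ring.
apply: (@le_trans _ _ (((1 + h) ^+ m.+1) ^+ 2 * r ^+ m.+1)).
  have mh : 0 <= m.+1%:R * h by rewrite mulr_ge0// ltW.
  have mhb : m.+1%:R * h <= (1 + h) ^+ m.+1.
    by apply: le_trans (bernoulli_ineq m.+1 _); lra.
  by rewrite ler_wpM2r ?exprn_ge0// lerXn2r ?nnegrE// (le_trans mh).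
by rewrite exprAC -exprMn exprn_ile1// mulr_ge0// sqr_ge0.
Qed.

Lemma step_poly_cvg u : 0 <= u <= 1 ->
  step_poly m u @[m --> \oo] --> ((u < 2^-1)%R%:R : R).
Proof.
move=> u01; have /andP[u0 u1] := u01; case: ltP => u2.
  have /step_poly_ge[C hC] : 0 <= u < 2^-1 by rewrite u0.
  apply: (@squeeze_cvgr _ _ _ _ (fun m => 1 - C * m%:R^-1) (fun=> 1)).
  - by near=> m; rewrite hC/=; have /andP[] := step_poly_itv m u01.
  - rewrite -[X in _ --> X]subr0 -(mulr0 C); apply: cvgB; first exact: cvg_cst.
    by apply: cvgMr; rewrite -cvg_shiftS; exact: cvg_harmonic.
  - exact: cvg_cst.
apply: (@squeeze_cvgr _ _ _ _ (fun=> 0) (@harmonic R)).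
- by near=> m; rewrite step_poly_le ?u2//= andbT; have /andP[] := step_poly_itv m u01.
- exact: cvg_cst.
- exact: cvg_harmonic.
Unshelve. all: by end_near. Qed.

End StepPolynomials.

(** * Trigonometric polynomials *)

Section TrigonometricPolynomials.
Context {R : realType}.
Local Notation X := (borel (inf_torus R)).
Implicit Types (f g : inf_torus R -> R).

Definition trig_sum (s : seq (R * {poly int} * R)) (th : inf_torus R) : R :=
  \sum_(x <- s) x.1.1 * character x.1.2 x.2 th.

Definition trigonometric f := exists s, f = trig_sum s.

Lemma trigD f g : trigonometric f -> trigonometric g ->
  trigonometric (fun th => f th + g th).
Proof.
move=> [s ->] [t ->]; exists (s ++ t); apply/funext => th.
by rewrite /trig_sum big_cat.
Qed.

Lemma trig_character a p b : trigonometric (fun th => a * character p b th).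
Proof. by exists [:: (a, p, b)]; apply/funext => th; rewrite /trig_sum big_seq1. Qed.

Lemma trig_cst a : trigonometric (fun=> a).
Proof.
rewrite (_ : (fun=> a) = (fun th => a * character 0 0 th)); first exact: trig_character.
by apply/funext => th; rewrite character0 cos0 mulr1.
Qed.

(** By the product formula [characterM], frequencies add and subtract. *)
Lemma trigM f g : trigonometric f -> trigonometric g ->
  trigonometric (fun th => f th * g th).
Proof.
have single a p b t : trigonometric (fun th => a * character p b th * trig_sum t th).
  elim: t => [|[[c q] e] t IH].
    rewrite (_ : (fun _ => _) = fun=> 0); first exact: trig_cst.
    by apply/funext => th; rewrite /trig_sum big_nil mulr0.
  rewrite (_ : (fun _ => _) = fun th => (a * c / 2 * character (p + q) (b + e) th +
    a * c / 2 * character (p - q) (b - e) th) + a * character p b th * trig_sum t th).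
    by apply: trigD => //; apply: trigD; exact: trig_character.
  apply/funext => th; rewrite /trig_sum big_cons/= mulrDr; congr (_ + _).
  rewrite (_ : _ * _ = a * c * (character p b th * character q e th)); last by ring.
  by rewrite characterM; ring.
move=> [s ->] [t ->]; elim: s => [|[[a p] b] s IH].
  rewrite (_ : (fun _ => _) = fun=> 0); first exact: trig_cst.
  by apply/funext => th; rewrite /trig_sum big_nil mul0r.
rewrite (_ : (fun _ => _) = fun th => a * character p b th * trig_sum t th +
  trig_sum s th * trig_sum t th); first exact: trigD.
by apply/funext => th; rewrite {1}/trig_sum big_cons mulrDl.
Qed.

Lemma trigX f n : trigonometric f -> trigonometric (fun th => f th ^+ n).
Proof.
move=> tf; elim: n => [|n IH]; first exact: trig_cst.
by under eq_fun do rewrite exprS; exact: trigM.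
Qed.

Lemma measurable_trig f : trigonometric f -> measurable_fun setT (f : X -> R).
Proof.
move=> [s ->]; apply: measurable_sum => -[[a p] b].
by apply: measurable_funM => //; exact: measurable_character.
Qed.

Lemma integrable_character (mu : probability X R) p b :
  mu.-integrable setT (EFin \o (character p b : X -> R)).
Proof.
by apply: integrable_le1; [exact: measurable_character|exact: character_norm_le1].
Qed.

Lemma integrable_trig (mu : probability X R) f : trigonometric f ->
  mu.-integrable setT (EFin \o (f : X -> R)).
Proof.
move=> [s ->]; elim: s => [|[[a p] b] s IH].
  rewrite (_ : _ \o _ = cst 0%E); first exact: integrable0.
  by apply/funext => th; rewrite /= /trig_sum big_nil.
rewrite (_ : _ \o _ = ((fun th => a%:E * (character p b th)%:E) \+ (EFin \o trig_sum s))%E).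
  by apply: integrableD => //; apply: integrableZl => //; exact: integrable_character.
by apply/funext => th; rewrite /= /trig_sum big_cons.
Qed.

Lemma integral_trig_sum (mu : probability X R) s :
  \int[mu]_th trig_sum s th = \sum_(x <- s) x.1.1 * \int[mu]_th character x.1.2 x.2 th.
Proof.
elim: s => [|[[a p] b] s IH].
  rewrite big_nil; under eq_Rintegral do rewrite /trig_sum big_nil.
  by rewrite Rintegral_cst// mul0r.
rewrite big_cons/= -IH -RintegralZl//; last exact: integrable_character.
rewrite -RintegralD//; last 2 first.
- by apply: (integrable_trig mu (trig_character a p b)).
- by apply: integrable_trig; exists s.
by apply: eq_Rintegral => th _; rewrite /trig_sum big_cons.
Qed.

End TrigonometricPolynomials.

(** * Fourier coefficients determine a Borel probability *)

Section BoxApproximation.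
Context {R : realType}.
Local Notation X := (borel (inf_torus R)).
Implicit Types (i : nat * rat * nat) (th : inf_torus R).

(** An affine function of a character, scaled so that its values lie in the unit
    interval and the arc is where it is below [1/2]. *)
Definition arc_gauge i th : R :=
  2^-1 + 4^-1 * cos (arc_radius i.2) - 4^-1 * character 'X^(i.1.1) (- ratr i.1.2) th.

Lemma arc_gauge_itv i th : 0 <= arc_gauge i th <= 1.
Proof.
rewrite /arc_gauge; have := character_norm_le1 'X^(i.1.1) (- ratr i.1.2) th.
have := cos_max (arc_radius i.2 : R); rewrite !ler_norml.
by move=> /andP[? ?] /andP[? ?]; apply/andP; split; lra.
Qed.

Lemma arc_gaugeE i th : torus_arc i th <-> arc_gauge i th < 2^-1.
Proof. by rewrite /torus_arc /arc_gauge/=; split=> h; lra. Qed.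

Definition box_approx s m th : R := \prod_(i <- s) step_poly m (arc_gauge i th).

Lemma trig_box_approx s m : trigonometric (box_approx s m).
Proof.
elim: s => [|i s IH].
  rewrite (_ : box_approx _ _ = fun=> 1); first exact: trig_cst.
  by apply/funext => th; rewrite /box_approx big_nil.
rewrite (_ : box_approx _ _ = fun th => step_poly m (arc_gauge i th) * box_approx s m th).
  apply: trigM => //; apply: trigX.
  rewrite (_ : (fun _ => _) = fun th => 1 + -1 * (arc_gauge i th) ^+ m).
    apply: trigD; first exact: trig_cst.
    apply: trigM; first exact: trig_cst.
    apply: trigX.
    rewrite (_ : arc_gauge i = fun th => (2^-1 + 4^-1 * cos (arc_radius i.2)) +
      (- 4^-1) * character 'X^(i.1.1) (- ratr i.1.2) th).
      by apply: trigD; [exact: trig_cst|exact: trig_character].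
    by apply/funext => th; rewrite mulNr.
  by apply/funext => th; rewrite mulN1r.
by apply/funext => th; rewrite /box_approx big_cons.
Qed.

Lemma box_approx_itv s m th : 0 <= box_approx s m th <= 1.
Proof.
rewrite prodr_ge0 /=; last first.
  by move=> i _; have /andP[] := step_poly_itv m (arc_gauge_itv i th).
by apply: prodr_ile1 => i _; exact: step_poly_itv (arc_gauge_itv i th).
Qed.

(** Outside a box some arc condition fails, and the corresponding factor alone
    is small. *)
Lemma box_approx_le s m th : ~ box s th -> box_approx s m th <= m.+1%:R^-1.
Proof.
elim: s => [|i s IH]; first by rewrite box_nil => /(_ Logic.I).
rewrite box_cons /box_approx big_cons -/(box_approx s m th) => nb.
have /andP[p0 p1] := step_poly_itv m (arc_gauge_itv i th).
have /andP[q0 q1] := box_approx_itv s m th.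
have [/arc_gaugeE ai|ai] := ltP (arc_gauge i th) 2^-1.
  by apply: le_trans (IH _); [rewrite ler_piMl|move=> bs; apply: nb].
apply: (@le_trans _ _ (step_poly m (arc_gauge i th))); first by rewrite ler_piMr.
by apply: step_poly_le; rewrite ai; have /andP[] := arc_gauge_itv i th.
Qed.

Lemma box_approx_cvg s th : box_approx s m th @[m --> \oo] --> (\1_(box s) th : R).
Proof.
elim: s => [|i s IH].
  rewrite box_nil indicE in_setT; under eq_fun do rewrite /box_approx big_nil.
  exact: cvg_cst.
under eq_fun do rewrite /box_approx big_cons.
rewrite box_cons indicI/=; apply: cvgM; last exact: IH.
have := @step_poly_cvg R _ (arc_gauge_itv i th).
rewrite indicE (_ : (th \in torus_arc i) = (arc_gauge i th < 2^-1)) //.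
by apply/idP/idP; rewrite inE => /arc_gaugeE.
Qed.

Lemma integral_box_approx_cvg (mu : probability X R) s :
  \int[mu]_th box_approx s m th @[m --> \oo] --> fine (mu (box s)).
Proof.
apply: fine_cvg; rewrite -[X in _ --> X](_ : \int[mu]_th (\1_(box s) th)%:E = _)%E; last first.
  by rewrite fineK ?fin_num_measure ?integral_indic ?setIT//; exact: measurable_box.
apply: (@dominated_cvg _ _ _ mu setT measurableT _ _ (cst 1%E)) => //.
- by move=> m; apply/measurable_EFinP; apply: measurable_trig; exact: trig_box_approx.
- by move=> th _; apply: cvg_EFin; [exact: nearW|exact: box_approx_cvg].
- exact: (finite_measure_integrable_cst mu 1).
- move=> m th _; rewrite lee_fin; have /andP[? ?] := box_approx_itv s m th.
  by rewrite ger0_norm.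
Qed.

(** The probabilities agree on trigonometric polynomials, hence by dominated
    convergence on boxes, which are stable under intersection and generate the
    Borel sets. *)
Lemma fourier_uniqueness (mu nu : probability X R) :
  (forall p b, \int[mu]_th character p b th = \int[nu]_th character p b th) ->
  forall U : set X, measurable U -> mu U = nu U.
Proof.
move=> munu U mU.
apply: (@measure_unique _ R X (range (@box R)) (fun=> setT) _ _ _ _ mu nu _ _ U mU) => //.
- exact: borel_boxes.
- by move=> _ _ [s _ <-] [t _ <-]; exists (s ++ t) => //; rewrite box_cat.
- by move=> _; exists [::] => //; rewrite box_nil.
- by rewrite bigcup_const.
- move=> _ [s _ <-].
  rewrite -[LHS]fineK ?fin_num_measure -1?[RHS]fineK ?fin_num_measure//;
    try exact: measurable_box.
  congr EFin; have := @integral_box_approx_cvg nu s.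
  have -> : (fun m => \int[nu]_th box_approx s m th) =
      (fun m => \int[mu]_th box_approx s m th).
    apply/funext => m; have [t ->] := trig_box_approx s m.
    by rewrite !integral_trig_sum; apply: eq_bigr => x _; rewrite munu.
  move=> cn; exact: (cvg_unique _ (@integral_box_approx_cvg mu s) cn).
- by move=> _; rewrite [ltLHS]probability_setT ltry.
Qed.

End BoxApproximation.

(** * Flipping a binary digit *)

Section BinaryDigits.
Context {R : realType}.
Implicit Types (x : R) (m n : nat).

Definition dyad n x : int := Num.floor (x * 2 ^+ n).

(** The digit of weight [2 ^- n.+1] in the binary expansion of [x]. *)
Definition bit n x : int := dyad n.+1 x - 2 * dyad n x.

Definition flip n x : R := x + (1 - 2 * bit n x)%:~R / 2 ^+ n.+1.

Lemma dyad_half n x : 2 * dyad n x <= dyad n.+1 x <= 2 * dyad n x + 1.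
Proof.
have /andP[] := floor_itv (x * 2 ^+ n); rewrite -/(dyad n x) => l u.
rewrite /dyad floor_ge_int -ltzD1 floor_lt_int exprSr mulrA !intrD !intrM -/(dyad n x).
by rewrite intrD in u; apply/andP; split; lra.
Qed.

Lemma bit_itv n x : 0 <= bit n x <= 1.
Proof. by have := dyad_half n x; rewrite /bit; lia. Qed.

Lemma dyad_shift m n x (z : int) : (n <= m)%N ->
  dyad m (x + z%:~R / 2 ^+ n) = dyad m x + z * 2 ^+ (m - n).
Proof.
move=> nm; rewrite /dyad (_ : _ * _ = x * 2 ^+ m + (z * 2 ^+ (m - n))%:~R).
  by rewrite floorDrz ?intrKfloor// intr_int.
rewrite mulrDl intrM rmorphXn/= -mulrA; congr (_ + _ * _).
by rewrite -[in LHS](subnK nm) exprD mulrC -mulrA divff ?mulr1// expf_neq0.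
Qed.

Lemma dyad_flip n x : dyad n.+1 (flip n x) = dyad n.+1 x + (1 - 2 * bit n x).
Proof. by rewrite dyad_shift// subnn mulr1. Qed.

(** Flipping a digit cannot change the coarser dyadic truncations: each of them
    is determined by the next finer one, by halving. *)
Lemma dyad_flip_le m n x : (m <= n)%N -> dyad m (flip n x) = dyad m x.
Proof.
move=> mn; rewrite -(subKn mn); move: (n - m)%N (leq_subr m n) => k.
elim: k => [_|k IH kn].
  rewrite subn0; have := dyad_flip n x; have := dyad_half n (flip n x).
  by have := bit_itv n x; rewrite /bit; lia.
have := IH (ltnW kn); rewrite -(subnSK kn).
have := dyad_half (n - k.+1) (flip n x); have := dyad_half (n - k.+1) x.
by set a := dyad _ x; set b := dyad _ (flip _ _) => ? ? ?; lia.
Qed.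

Lemma bit_flip n x : bit n (flip n x) = 1 - bit n x.
Proof. by rewrite {1}/bit dyad_flip dyad_flip_le// /bit; lia. Qed.

Lemma bit_flip_neq m n x : m != n -> bit m (flip n x) = bit m x.
Proof.
case: ltngtP => // mn _; first by rewrite /bit !dyad_flip_le// ltnW.
rewrite /bit /flip !dyad_shift//; last by rewrite ltnS ltnW.
by rewrite subSS -(subnSK mn) exprS; lia.
Qed.

Lemma flipK n : involutive (flip n).
Proof.
move=> x; rewrite {1}/flip bit_flip /flip -addrA -mulrDl -intrD.
by rewrite (_ : _ + _ = 0 :> int) ?mul0r ?addr0//; lia.
Qed.

Lemma measurable_dyad n : measurable_fun setT (fun x => (dyad n x)%:~R : R).
Proof.
apply: nondecreasing_measurable => // x y xy; rewrite ler_int le_floor//.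
by rewrite ler_wpM2r// exprn_ge0.
Qed.

Lemma measurable_bit n : measurable_fun setT (fun x => (bit n x)%:~R : R).
Proof.
rewrite (_ : (fun _ => _) = fun x => (dyad n.+1 x)%:~R - 2 * (dyad n x)%:~R).
  apply: measurable_funB; first exact: measurable_dyad.
  by apply: measurable_funM => //; exact: measurable_dyad.
by apply/funext => x; rewrite intrB intrM.
Qed.

Lemma measurable_bit_eq n (c : int) : measurable [set x | bit n x = c].
Proof.
rewrite (_ : [set _ | _] = [set x | (bit n x)%:~R == c%:~R :> R]).
  rewrite -[X in measurable X]setTI; apply: measurable_fun_eqr => //.
  exact: measurable_bit.
by apply/seteqP; split => x /=; [move=> ->|rewrite eqr_int => /eqP].
Qed.

Lemma measurable_flip n : measurable_fun setT (flip n).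
Proof.
rewrite (_ : flip n = fun x => x + (1 - 2 * (bit n x)%:~R) * (2 ^+ n.+1)^-1).
  apply: measurable_funD => //; apply: measurable_funM => //.
  by apply: measurable_funB => //; apply: measurable_funM => //; exact: measurable_bit.
by apply/funext => x; rewrite /flip intrB intrM.
Qed.

Lemma flip_unit_itv n x : (0 <= flip n x < 1) = (0 <= x < 1).
Proof.
have unitE y : (0 <= y < 1) = (dyad 0 y == 0).
  by rewrite /dyad floor_eq mulr1 add0r.
by rewrite !unitE dyad_flip_le.
Qed.

End BinaryDigits.

Section CoinFlips.
Context {R : realType}.

Lemma lebesgue_measure_shift (h : R) (A : set R) : measurable A ->
  lebesgue_measure ((fun x => x + h) @^-1` A) = lebesgue_measure A.
Proof.
move=> mA; pose B := measurableTypeR R.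
have mh : @measurable_fun _ _ B B setT (fun x => x + h) by apply: measurable_funD.
pose shift_fun : {mfun B >-> B} := @mfun_Sub _ _ B B _ (mem_set mh).
apply/esym.
apply: (lebesgue_measure_unique (mu := pushforward lebesgue_measure shift_fun)) => //.
move=> _ [[a b] _ <-] /=.
have -> : pushforward lebesgue_measure shift_fun `]a, b]%classic =
    lebesgue_measure `]a - h, b - h]%classic.
  congr lebesgue_measure; apply/seteqP.
  by split => x /=; rewrite !in_itv/= ltrBlDr lerBrDr.
rewrite !lebesgue_measure_itv/= !lte_fin ltrD2r; case: ifP => // _.
by rewrite -!EFinB; congr EFin; lra.
Qed.

Definition unit_measure := mrestr (@lebesgue_measure R) (measurable_itv `[0, 1[).

HB.instance Definition _ := Measure.on unit_measure.

Let unit_measureT : unit_measure setT = 1%E.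
Proof.
by rewrite /unit_measure /mrestr setTI lebesgue_measure_itv/= lte_fin ltr01 oppr0 adde0.
Qed.

HB.instance Definition _ := Measure_isProbability.Build _ _ _ unit_measure unit_measureT.

(** On each of the two sets where the flipped digit is constant, the flip is a
    translation onto the other set. *)
Lemma unit_measure_flip n (U : set R) : measurable U ->
  unit_measure (flip n @^-1` U) = unit_measure U.
Proof.
move=> mU; pose h : R := (2 ^+ n.+1)^-1.
pose half c (V : set R) := V `&` `[0, 1[ `&` [set x | bit n x = c].
have mhalf c V : measurable V -> measurable (half c V).
  by move=> mV; apply: measurableI; [exact: measurableI|exact: measurable_bit_eq].
have split_half V : measurable V ->
    unit_measure V = (lebesgue_measure (half 0%R V) + lebesgue_measure (half 1%R V))%E.
  move=> mV; rewrite /unit_measure /mrestr -measureU; try exact: mhalf.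
    congr lebesgue_measure; rewrite /half -setIUr; apply/esym/setIidl => x _ /=.
    by have := bit_itv n x; lia.
  by apply/seteqP; split=> x //= -[[_ b0] [_ b1]]; move: b0; rewrite /= b1.
have mfU : measurable (flip n @^-1` U).
  by rewrite -[X in measurable X]setTI; exact: measurable_flip.
have flip_half c : lebesgue_measure (half c (flip n @^-1` U)) =
    lebesgue_measure (half (1 - c) U).
  rewrite -[RHS](lebesgue_measure_shift ((1 - 2 * c)%:~R * h)); last exact: mhalf.
  congr lebesgue_measure; apply/seteqP; split=> x.
    move=> [[/= Ux xI] bc]; have fx : flip n x = x + (1 - 2 * c)%:~R * h by rewrite /flip bc.
    by rewrite /half/= -fx bit_flip bc; move: xI; rewrite !in_itv/= flip_unit_itv.
  pose y := x + (1 - 2 * c)%:~R * h; rewrite -[preimage _ _ x]/(half (1 - c) U y).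
  move=> [[/= Uy yI] /= bc].
  have fy : flip n y = x.
    rewrite /flip bc /y -/h -addrA -mulrDl -intrD.
    by rewrite (_ : _ + _ = 0 :> int) ?mul0r ?addr0//; lia.
  rewrite /half/= -fy flipK bit_flip bc; split; last by lia.
  by move: yI; rewrite !in_itv/= flip_unit_itv.
by rewrite !split_half// !flip_half subr0 subrr addeC.
Qed.

End CoinFlips.

(** * Haar measure on the torus *)

Section Law.
Context d (T : measurableType d) {R : realType} (P : probability T R).
Local Notation X := (borel (inf_torus R)).
Variable Th : T -> nat -> R.
Hypothesis mTh : forall j, measurable_fun setT (Th^~ j).

Lemma measurable_cos_phase p b : measurable_fun setT (fun x => cos (phase p (Th x) + b)).
Proof.
apply: (measurableT_comp (f := @cos R)).
  by apply: continuous_measurable_fun; exact: continuous_cos.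
by apply: measurable_funD => //; exact: measurable_phase.
Qed.

Lemma measurable_torus_pt : measurable_fun setT (fun x => torus_pt (Th x) : X).
Proof.
apply: measurable_torus_fun => j b.
under eq_fun do rewrite character_torus_pt.
exact: measurable_cos_phase.
Qed.

Definition torus_law : probability X R :=
  distribution P (@mfun_Sub _ _ T X _ (mem_set measurable_torus_pt)).

Lemma integral_torus_law p b :
  \int[torus_law]_th character p b th = \int[P]_x cos (phase p (Th x) + b).
Proof.
rewrite Rintegral_distribution; last 2 first.
- exact: measurable_character.
- exact: character_norm_le1.
by apply: eq_Rintegral => x _; rewrite -character_torus_pt.
Qed.

End Law.

Section UniformAngles.
Context {R : realType}.
Implicit Types (x : R) (i j k m n : nat).

(** The pairing of [nat * nat] with [nat] gives every coordinate [j] a binary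
    digit sequence of its own. *)
Definition digit j k x : R := (bit (pickle (j, k)) x)%:~R / 2 ^+ k.+1.

Lemma cvg_digits j x : cvgn (series (fun k => digit j k x)).
Proof.
have digit_itv k : 0 <= digit j k x <= 1 / 2 ^+ k.+1.
  have /andP[b0 b1] := bit_itv (pickle (j, k)) x.
  rewrite mulr_ge0 ?ler0z ?invr_ge0 ?exprn_ge0//=.
  by rewrite ler_wpM2r ?invr_ge0 ?exprn_ge0// (ler_int _ _ 1).
apply: (@series_le_cvg _ _ (fun k => 1 / (2 ^ (k + 1))%:R)) => [k|k|k|].
- by case/andP: (digit_itv k).
- by rewrite divr_ge0.
- by rewrite addn1 natrX; case/andP: (digit_itv k).
- by apply/cvg_ex; eexists; exact: (@cvg_geometric_series_half _ 1 0).
Qed.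

Definition angles x j : R := 2 * pi * limn (series (fun k => digit j k x)).

Lemma measurable_angles j : measurable_fun setT (angles^~ j).
Proof.
apply: measurable_funM => //.
apply: (measurable_fun_cvg (h := fun n x => series (fun k => digit j k x) n)).
  move=> n; rewrite /series/=; apply: measurable_sum => k.
  by apply: measurable_funM => //; exact: measurable_bit.
by move=> x _; exact: cvg_digits.
Qed.

(** The flipped digit has weight [2 ^- m.+1] in the binary expansion of the
    [i]-th angle divided by [2 * pi], and occurs in no other angle. *)
Lemma angles_flip i m x j : angles (flip (pickle (i, m)) x) j =
  angles x j + (if j == i then pi * (1 - 2 * bit (pickle (i, m)) x)%:~R / 2 ^+ m else 0).
Proof.
have digit_flip k : (j, k) != (i, m) -> digit j k (flip (pickle (i, m)) x) = digit j k x.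
  move=> jk; rewrite /digit bit_flip_neq//.
  by apply: contraNneq jk => /(pcan_inj pickleK) ->.
case: eqP => [ji|/eqP ji].
  subst j; set c : R := pi * _ / _.
  pose e : R := (1 - 2 * bit (pickle (i, m)) x)%:~R / 2 ^+ m.+1.
  have cE : c = 2 * pi * e by rewrite /c /e exprS; field; rewrite expf_neq0.
  rewrite /angles cE -mulrDr; congr (_ * _); apply/cvg_lim => //.
  have cvgDe : series (fun k => digit i k x) N + e @[N --> \oo] -->
      limn (series (fun k => digit i k x)) + e.
    by apply: cvgD; [exact: cvg_digits|exact: cvg_cst].
  apply: cvg_trans cvgDe; apply: near_eq_cvg.
  have digit_m : digit i m (flip (pickle (i, m)) x) = digit i m x + e.
    by rewrite /digit bit_flip /e -mulrDl -intrD; congr (_%:~R / _); lia.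
  near=> N; have mN : (m < N)%N by near: N; exact: nbhs_infty_gt.
  rewrite /series/= !big_mkord [in LHS](bigD1 (Ordinal mN))//=.
  rewrite [RHS](bigD1 (Ordinal mN))//= digit_m [LHS]addrAC.
  congr (_ + _ + _); apply: eq_bigr => k km.
  by rewrite digit_flip// xpair_eqE eqxx.
rewrite addr0 /angles (_ : (fun k => _) = fun k => digit j k x)//.
by apply/funext => k; apply: digit_flip; rewrite xpair_eqE (negbTE ji).
Unshelve. all: by end_near. Qed.

Lemma int_odd_part (z : int) : z != 0 -> exists m (q : int), z = (2 * q + 1) * 2 ^+ m.
Proof.
move=> z0; have z0' : (0 < `|z|)%N by rewrite absz_gt0.
have [k k2 zk] := @pfactor_coprime 2 `|z|%N isT z0'.
have kE : k%:Z = 2 * k./2%:Z + 1.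
  by rewrite -[in LHS](odd_double_half k) -coprime2n k2; lia.
move: (logn 2 _) zk => l zk; exists l.
(* Negating an odd number [2 * q + 1] replaces [q] by [- q - 1]. *)
exists (if 0 <= z then k./2%:Z else - k./2%:Z - 1).
have zE : `|z|%N%:Z = (2 * k./2%:Z + 1) * 2 ^+ l.
  by rewrite zk PoszM kE -[(2 ^ l)%N%:Z]natz natrX.
case: (ltrgtP z 0) z0 => // z_sg _; last by rewrite -zE; lia.
rewrite (_ : 2 * _ + 1 = - (2 * k./2%:Z + 1)); last by lia.
by rewrite mulNr -zE; lia.
Qed.

Definition haar : probability (borel (inf_torus R)) R :=
  torus_law (@unit_measure R) measurable_angles.

(** Pick a nonzero coefficient [p_i] and write it as an odd number times
    [2 ^ m].  Flipping the digit [(i, m)] moves the phase by an odd multiple of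
    [pi], which changes the sign of the integrand, and preserves the measure. *)
Lemma integral_angles_eq0 p b : p != 0 ->
  \int[@unit_measure R]_x cos (phase p (angles x) + b) = 0.
Proof.
move=> p0; pose i := (size p).-1.
have /int_odd_part[m [q pi_odd]] : p`_i != 0 by rewrite lead_coef_eq0.
pose n := pickle (i, m); pose f x : R := cos (phase p (angles x) + b).
have f_flip x : f (flip n x) = - f x.
  rewrite /f (_ : angles (flip n x) = fun j => angles x j +
    (if j == i then pi * (1 - 2 * bit n x)%:~R / 2 ^+ m else 0)); last first.
    by apply/funext => j; rewrite angles_flip.
  rewrite phaseDr phase_single pi_odd addrAC.
  rewrite (_ : _ * (_ / _) = pi * (2 * ((1 - 2 * bit n x) * q - bit n x) + 1)%:~R).
    exact: cosD_odd_pi.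
  rewrite (_ : 2 * (_ - _) + 1 = (2 * q + 1) * (1 - 2 * bit n x) :> int); last by ring.
  by rewrite !intrM rmorphXn/=; field; rewrite expf_neq0.
have mf : measurable_fun setT f by exact: measurable_cos_phase measurable_angles _ _.
have f1 x : `|f x| <= 1 by exact: cos_max.
pose B := measurableTypeR R.
have mflip : @measurable_fun _ _ B B setT (flip n) by exact: measurable_flip.
have := @Rintegral_invariant _ _ _ (@unit_measure R)
  (@mfun_Sub _ _ B B _ (mem_set mflip)) f (unit_measure_flip n) mf f1.
under eq_Rintegral do rewrite /= f_flip -mulN1r.
rewrite RintegralZl//; last exact: integrable_le1.
by rewrite -/f; lra.
Qed.

Lemma haar_character p b : p != 0 -> \int[haar]_th character p b th = 0.
Proof. by move=> p0; rewrite integral_torus_law integral_angles_eq0. Qed.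

End UniformAngles.

(** * Translations *)

Section Translations.
Context {R : realType}.
Local Notation X := (borel (inf_torus R)).
Implicit Types (a omega : nat -> R) (p : {poly int}).

Lemma measurable_translate a : measurable_fun setT (translate a : X -> X).
Proof.
apply: measurable_torus_fun => j b.
under eq_fun do rewrite character_translate.
exact: measurable_character.
Qed.

Definition translate_mfun a : {mfun X >-> X} :=
  @mfun_Sub _ _ X X _ (mem_set (measurable_translate a)).

Lemma integral_translate (mu : probability X R) a p b :
  \int[distribution mu (translate_mfun a)]_th character p b th =
  \int[mu]_th character p (phase p a + b) th.
Proof.
rewrite Rintegral_distribution; last 2 first.
- exact: measurable_character.
- exact: character_norm_le1.
by apply: eq_Rintegral => th _; rewrite -character_translate.
Qed.

Lemma integral_character0 (mu : probability X R) b :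
  \int[mu]_th character 0 b th = cos b.
Proof.
under eq_Rintegral do rewrite character0.
by rewrite Rintegral_cst// [X in fine X]probability_setT mulr1.
Qed.

(** Translating a probability only shifts the phases of its characters, so this
    applies to the translates of [haar], which is therefore translation
    invariant. *)
Lemma haar_unique (mu : probability X R) :
  (forall p b, p != 0 -> \int[mu]_th character p b th = 0) ->
  forall U : set X, measurable U -> mu U = haar U.
Proof.
move=> mu0; apply: fourier_uniqueness => p b.
have [->|p0] := eqVneq p 0; first by rewrite !integral_character0.
by rewrite mu0// haar_character.
Qed.

Lemma invariant_of_fourier omega (mu : probability X R) :
  (forall p b, phase p omega != 0 -> \int[mu]_th character p b th = 0) ->
  invariant_measure (kronecker_flow omega) mu.
Proof.
move=> mu0 t U mU.
apply: (@fourier_uniqueness _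
  (distribution mu (translate_mfun (fun j => omega j * t))) mu) => //.
move=> p b; rewrite integral_translate phaseZr.
have [->|p0] := eqVneq (phase p omega) 0; first by rewrite mul0r add0r.
by rewrite !mu0.
Qed.

Lemma haar_translate a (U : set X) : measurable U -> haar (translate a @^-1` U) = haar U.
Proof.
move=> mU; apply: (@haar_unique (distribution haar (translate_mfun a))) => // p b p0.
by rewrite integral_translate haar_character.
Qed.

Lemma open_arcs_fiber (s : seq (nat * rat * nat)) j :
  open [set z : R | forall i, i \in s -> i.1.1 = j ->
    cos (arc_radius i.2) < cos (z - ratr i.1.2)].
Proof.
pose V i := [set z : R | i.1.1 = j -> cos (arc_radius i.2) < cos (z - ratr i.1.2)].
elim: s => [|i s IH].
  by rewrite (_ : [set _ | _] = setT); [exact: openT|apply/seteqP; split].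
rewrite (_ : [set _ | _] = V i `&` [set z : R | forall i, i \in s -> V i z]).
  apply: openI; last exact: IH.
  have [ij|ij] := eqVneq i.1.1 j.
    rewrite (_ : V i = (fun z => cos (z - ratr i.1.2)) @^-1`
        [set y | cos (arc_radius i.2) < y]).
      apply: open_comp; last exact: open_gt.
      move=> z _; apply: continuous_comp; last exact: continuous_cos.
      by apply: cvgB; [exact: cvg_id|exact: cvg_cst].
    by apply/seteqP; split => z; [move=> /(_ ij)|move=> h _].
  rewrite (_ : V i = setT); first exact: openT.
  by apply/seteqP; split => z // _ /= e; rewrite e eqxx in ij.
apply/seteqP; split => z /=.
  by move=> h; split=> [|k ks]; apply: h; rewrite inE ?eqxx ?ks ?orbT.
by move=> [hi hs] k; rewrite inE => /orP[/eqP ->|/hs].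
Qed.

(** The arc conditions are open and concern finitely many coordinates, so a
    translation with finitely many nonzero rational coordinates moves any given
    point into the box. *)
Lemma rat_translate_box s (y th : inf_torus R) : box s y ->
  exists q : seq rat, box s (translate (fun j => ratr q`_j) th).
Proof.
move=> ys; pose W j := [set z : R | forall i, i \in s -> i.1.1 = j ->
  cos (arc_radius i.2) < cos (z - ratr i.1.2)].
have : forall j, exists r : rat, W j (coords th j + ratr r).
  (* [V] is the set of admissible [j]-th coordinates of a translation. *)
  move=> j; pose V := [set z : R | W j (coords th j + z)].
  have oV : open V.
    apply: (open_comp (f := fun z => coords th j + z)); last exact: open_arcs_fiber.
    by move=> z _; apply: cvgD; [exact: cvg_cst|exact: cvg_id].
  have V0 : V !=set0.
    exists (coords y j - coords th j) => i si ij; rewrite addrCA subrr addr0 -ij.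
    by apply/torus_arcE; exact: ys.
  by have [z [Vz [r _ rz]]] := dense_rat V0 oV; exists r; rewrite rz.
move=> /choice[r Wr]; pose n := (\max_(i <- s) i.1.1).+1.
exists (mkseq r n) => i si; rewrite /torus_arc/= character_translate phaseXn nth_mkseq.
  by rewrite /character phaseXn addrA; exact: Wr.
by rewrite ltnS; exact: (@leq_bigmax_seq _ s xpredT (fun i => i.1.1)).
Qed.

(** Countably many translates of the box cover the torus and have the same
    measure, so this measure cannot be [0]. *)
Lemma haar_box_gt0 s (y : inf_torus R) : box s y -> (0 < haar (box s : set X))%E.
Proof.
move=> ys; rewrite lt_def measure_ge0 andbT; apply/negP => /eqP h0.
pose F n : set X := if @unpickle (seq rat) n is Some q
  then translate (fun j => ratr q`_j) @^-1` box s else set0.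
have mF n : measurable (F n).
  rewrite /F; case: unpickle => [q|]; last exact: measurable0.
  rewrite -[X in measurable X]setTI; apply: measurable_translate => //.
  exact: measurable_box.
have F0 n : haar (F n) = 0%E.
  rewrite /F; case: unpickle => [q|]; last exact: measure0.
  by rewrite haar_translate//; exact: measurable_box.
have : (haar (setT : set X) <= \sum_(0 <= n <oo) haar (F n))%E.
  apply: measure_sigma_subadditive => // th _.
  have [q hq] := rat_translate_box th ys.
  by exists (pickle q) => //; rewrite /F pickleK.
by rewrite probability_setT eseries0// lee_fin ler10.
Qed.

End Translations.

(** * Constant terms of trigonometric sums on a line *)

Section AlmostPeriodic.
Context {R : realType}.

(** Averaging over the translation by [pi / alpha] removes the terms of
    frequency [alpha], only damps and shifts the others, and leaves the constant
    term and the bound unchanged. *)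
Lemma constant_term_le (s : seq (R * R * R)) (e : R) :
  (forall t, \sum_(x <- s) x.1.1 * cos (x.1.2 * t + x.2) <= e) ->
  \sum_(x <- s | x.1.2 == 0) x.1.1 * cos x.2 <= e.
Proof.
move sn : (size s) => n; elim: n s sn e => [|n IH] [|[[a al] b] s]//= => [_|[sn]] e.
  by move=> /(_ 0); rewrite !big_nil.
have [-> h|al0 h] := eqVneq al 0.
  rewrite big_cons/= eqxx -lerBrDl; apply: IH => // t.
  by have := h t; rewrite big_cons/= mul0r add0r lerBrDl.
rewrite big_cons/= (negbTE al0); pose tau := pi / al.
(* The mean of a term and its translate by [tau] is the term with amplitude
   multiplied by [cos (alpha * tau / 2)] and phase shifted by [alpha * tau / 2]. *)
pose damp (x : R * R * R) := (x.1.1 * cos (x.1.2 * tau / 2), x.1.2, x.2 + x.1.2 * tau / 2).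
have -> : \sum_(x <- s | x.1.2 == 0) x.1.1 * cos x.2 =
    \sum_(x <- map damp s | x.1.2 == 0) x.1.1 * cos x.2.
  rewrite big_map; apply: eq_bigr => x /eqP x0.
  by rewrite /= x0 !mul0r cos0 mulr1 addr0.
apply: IH => [|t]; first by rewrite size_map.
have := lerD (h t) (h (t + tau)); rewrite !big_cons/=.
have -> : cos (al * (t + tau) + b) = - cos (al * t + b).
  by rewrite mulrDr addrAC /tau mulrCA divff// mulr1 cosDpi.
rewrite mulrN addrACA subrr add0r -big_split/= big_map/=.
rewrite (eq_bigr (fun x => 2 * (x.1.1 * cos (x.1.2 * tau / 2) *
    cos (x.1.2 * t + (x.2 + x.1.2 * tau / 2))))) => [|x _].
  by rewrite -mulr_sumr; lra.
rewrite -mulrDr; set c := x.1.2 * tau / 2; set d := _ + (_ + c).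
have -> : x.1.2 * t + x.2 = d - c by rewrite /d; ring.
have -> : x.1.2 * (t + tau) + x.2 = d + c by rewrite /d /c; field.
by move: (d) (c) => u v; rewrite cosB cosD; ring.
Qed.

End AlmostPeriodic.

(** * Kronecker flows *)

Section Kronecker.
Context {R : realType}.
Local Notation X := (borel (inf_torus R)).
Implicit Types (omega : nat -> R) (p : {poly int}).

Lemma resonance_moduleE omega p :
  resonance_module omega (fun j => p`_j) <-> phase p omega = 0.
Proof.
have pN : [set j | p`_j != 0] `<=` `I_(size p).
  by move=> j /=; apply: contraR; rewrite -leqNgt => /(nth_default 0) ->.
have -> : phase p omega = \sum_(j \in [set: nat]) omega j * (p`_j)%:~R.
  rewrite /phase (fsbig_ord _ (size p) (fun j => (p`_j)%:~R * omega j)).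
  under eq_fsbigr do rewrite mulrC.
  apply: fsbig_widen => // j [_ /= jp]; rewrite nth_default ?mulr0// leqNgt.
  exact/negP.
split=> [[]//|p0]; split => //.
exact: sub_finite_set pN (finite_II _).
Qed.

Lemma non_resonantP omega :
  non_resonant omega <-> (forall p, phase p omega = 0 -> p = 0).
Proof.
split=> [nr p /resonance_moduleE|nr].
  rewrite nr => p0; apply/polyP => j.
  by rewrite coef0 (congr1 (@^~ j) p0).
apply/seteqP; split => [nu nu_res|_ ->]; last first.
  have := resonance_moduleE omega 0; rewrite phase0l.
  rewrite (_ : (fun j => (0 : {poly int})`_j) = 0); first by move=> h; exact/h.
  by apply/funext => j; rewrite coef0.
have [/finite_seqP[supp suppE] _] := nu_res.
pose n := (\max_(j <- supp) j).+1.
have nuE : (fun j => (\poly_(j < n) nu j)`_j) = nu.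
  apply/funext => j; rewrite coef_poly; case: ltnP => // nj.
  apply/esym/eqP; apply: contraTT nj => nuj; rewrite -ltnNge ltnS.
  have j_supp : [set` supp] j by rewrite -suppE.
  exact: (@leq_bigmax_seq _ _ xpredT id).
have /nr p0 : phase (\poly_(j < n) nu j) omega = 0 by apply/resonance_moduleE; rewrite nuE.
by rewrite /= -nuE p0; apply/funext => j; rewrite coef0.
Qed.

(** After the time [pi / phase p omega] a character of frequency [p] has become
    its opposite. *)
Lemma non_resonant_uniquely_ergodic omega :
  non_resonant omega -> uniquely_ergodic (kronecker_flow omega).
Proof.
move=> /non_resonantP nr; exists haar; split.
  apply: invariant_of_fourier => p b pw; apply: haar_character.
  by apply: contraNneq pw => ->; rewrite phase0l.
move=> nu nu_inv; apply: haar_unique => p b p0.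
have pw : phase p omega != 0 by apply: contraNneq p0 => /nr ->.
have := @Rintegral_invariant _ _ _ nu
  (translate_mfun (fun j => omega j * (pi / phase p omega))) (character p b)
  (nu_inv _) (@measurable_character _ p b) (character_norm_le1 p b).
under eq_Rintegral => th _ do rewrite [character _ _ _](character_flow p b omega).
rewrite mulrCA divff// mulr1.
under eq_Rintegral => th _ do rewrite /character addrCA addrC cosDpi -mulN1r.
rewrite RintegralZl//; last exact: integrable_character.
by rewrite -/(character _ _); lra.
Qed.

(** For a nonzero resonance [p], the image of [haar] under the endomorphism
    [theta_j |-> p_k * theta_j] for [j <> k],
    [theta_k |-> p_k * theta_k - phase p theta] is a second invariant
    probability: a frequency [q] pulls back to [p_k * q - q_k * p], which
    vanishes only if [q] is itself a resonance. *)
Lemma uniquely_ergodic_non_resonant omega :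
  uniquely_ergodic (kronecker_flow omega) -> non_resonant omega.
Proof.
move=> [mu [_ mu_unique]]; apply/non_resonantP => p p_res.
apply/eqP; apply: contraT => p0; pose k := (size p).-1.
have pk0 : p`_k != 0 by rewrite lead_coef_eq0.
pose Th (x : R) j := angles x j * (p`_k)%:~R +
  (if j == k then - phase p (angles x) else 0).
have mTh j : measurable_fun setT (Th^~ j).
  apply: measurable_funD; first by apply: measurable_funM => //; exact: measurable_angles.
  case: eqP => _ //; apply: measurableT_comp => //.
  by apply: measurable_phase; exact: measurable_angles.
have phaseTh q x : phase q (Th x) = phase (p`_k *: q - q`_k *: p) (angles x).
  rewrite phaseDr phaseZr phase_single phaseDl phaseNl !phaseZl; ring.
pose nu := torus_law (@unit_measure R) mTh.
have nu_inv : invariant_measure (kronecker_flow omega) nu.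
  apply: invariant_of_fourier => q b qw; rewrite integral_torus_law.
  under eq_Rintegral do rewrite phaseTh.
  apply: integral_angles_eq0; apply: contraNneq qw => /(congr1 (fun r => phase r omega)).
  rewrite phaseDl phaseNl !phaseZl p_res mulr0 subr0 phase0l => /eqP.
  by rewrite mulf_eq0 intr_eq0 (negbTE pk0).
have haar_inv : invariant_measure (kronecker_flow omega) (@haar R).
  apply: invariant_of_fourier => q b qw; apply: haar_character.
  by apply: contraNneq qw => ->; rewrite phase0l.
have : \int[nu]_th character p 0 th = \int[haar]_th character p 0 th.
  congr fine; apply: eq_measure_integral => U mU _.
  exact: (etrans (mu_unique _ nu_inv U mU) (esym (mu_unique _ haar_inv U mU))).
rewrite haar_character// integral_torus_law.
under eq_Rintegral do rewrite phaseTh subrr phase0l addr0 cos0.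
rewrite Rintegral_cst// [X in fine X]probability_setT mulr1 => /eqP.
by rewrite oner_eq0.
Qed.

(** Along the orbit the approximations of the indicator of the box are small
    trigonometric sums in the time, whose constant term is the integral against
    [haar] because no nonzero frequency resonates. *)
Lemma orbit_avoids_box omega s (th : inf_torus R) :
  (forall p, phase p omega = 0 -> p = 0) ->
  (forall t, ~ box s (kronecker_flow omega t th)) -> haar (box s : set X) = 0%E.
Proof.
move=> nr avoid.
have int_le m : \int[@haar R]_t box_approx s m t <= m.+1%:R^-1.
  have [l lE] := trig_box_approx (R := R) s m; rewrite lE integral_trig_sum.
  pose along (x : R * {poly int} * R) : R * R * R :=
    (x.1.1, phase x.1.2 omega, phase x.1.2 (coords th) + x.2).
  have const_le : \sum_(x <- map along l | x.1.2 == 0) x.1.1 * cos x.2 <= m.+1%:R^-1.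
    apply: constant_term_le => t.
    have := box_approx_le m (avoid t); rewrite lE; apply: le_trans.
    rewrite big_map le_eqVlt; apply/orP; left; apply/eqP; apply: eq_bigr => x _ /=.
    by rewrite character_flow /character addrCA addrA.
  apply: le_trans const_le; rewrite big_map [leRHS]big_mkcond le_eqVlt.
  apply/orP; left; apply/eqP; apply: eq_bigr => x _ /=.
  case: ifPn => [/eqP/nr ->|xw].
    by rewrite integral_character0 phase0l add0r.
  rewrite haar_character ?mulr0//.
  by apply: contraNneq xw => ->; rewrite phase0l.
have haar_fin : haar (box s : set X) \is a fin_num.
  by rewrite fin_num_measure//; exact: measurable_box.
apply/eqP; rewrite eq_le measure_ge0 andbT -(fineK haar_fin) lee_fin.
have cvg_haar := @integral_box_approx_cvg R haar s.
apply: (ler_cvg_to cvg_haar (@cvg_harmonic R)).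
by apply: nearW => m; exact: int_le.
Qed.

(** An orbit missing a nonempty open set would miss a nonempty box, which has
    positive measure. *)
Lemma non_resonant_minimal omega :
  non_resonant omega -> minimal (kronecker_flow omega).
Proof.
move=> /non_resonantP nr th O [y Oy] oO.
have [s sy sO] := box_base oO Oy.
apply: contrapT => avoid.
have := haar_box_gt0 sy; rewrite (@orbit_avoids_box omega s th nr) ?ltxx// => t bt.
apply: avoid; exists (kronecker_flow omega t th); split; first exact: sO.
by exists t.
Qed.

(** For a resonance [p], the character shifted so as to equal [1] at the given
    point equals [1] on its whole orbit; moving one coordinate by [pi / p_k]
    turns the value into [-1], so a nonempty open set avoids the orbit. *)
Lemma transitive_non_resonant omega :
  topologically_transitive (kronecker_flow omega) -> non_resonant omega.
Proof.
move=> [th th_dense]; apply/non_resonantP => p p_res.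
apply/eqP; apply: contraT => p0; pose k := (size p).-1.
have pk0 : (p`_k)%:~R != 0 :> R by rewrite intr_eq0 lead_coef_eq0.
pose b := - phase p (coords th).
have [||z [z_lt0 [t _ tE]]] := th_dense [set t | character p b t < 0].
- exists (torus_pt (fun j => coords th j + if j == k then pi / (p`_k)%:~R else 0)).
  rewrite /= character_torus_pt phaseDr phase_single mulrCA divff// mulr1.
  by rewrite /b addrAC subrr add0r cospi ltrN10.
- rewrite -[X in open X]/(character p b @^-1` [set y | y < 0]).
  apply: open_comp; last exact: open_lt.
  by move=> t _; exact: character_continuous.
move: z_lt0; rewrite -tE /= character_flow p_res mul0r add0r.
by rewrite /character subrr cos0 ltr10.
Qed.

End Kronecker.

Theorem theoremA (R : realType) (omega : nat -> R) :
  [<-> non_resonant omega;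
       uniquely_ergodic (kronecker_flow omega);
       minimal (kronecker_flow omega);
       topologically_transitive (kronecker_flow omega)].
Proof.
tfae.
- exact: non_resonant_uniquely_ergodic.
- by move=> /uniquely_ergodic_non_resonant; exact: non_resonant_minimal.
- by move=> min; exists point.
- exact: transitive_non_resonant.
Qed.
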